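(* Let $\kappa$ be an infinite cardinal and let $X$ be a $\kappa H''$-closed Hausdorff space. Then $aL'(X)\leq\kappa$.
   Context: An open ultrafilter on a Hausdorff space $X$ is a maximal filter in the family of open subsets of $X$ (its members are nonempty open sets); it converges to $x\in X$ if it contains every open set containing $x$. $EX$ is the set of all convergent open ultrafilters on $X$. A section is a function $b:X\to EX$ such that $b(x)$ converges to $x$ for every $x\in X$. For a section $b$ and an open set $U$ let $\widehat{U}_b=\{x\in X: U\in b(x)\}$, and for $A\subseteq X$ let $c_b(A)=\{x\in X:\widehat{U}_b\cap A\neq\varnothing\text{ for every open }U\ni x\}$. $A$ is $c_b$-closed if $c_b(A)=A$. For $A\subseteq X$, $aL(A,X)$ is the least infinite cardinal $\kappa$ such that every cover $\mathcal V$ of $A$ by open sets of $X$ has a subfamily $\mathcal W$ with $|\mathcal W|\leq\kappa$ and $A\subseteq\bigcup_{W\in\mathcal W}cl\,W$. Put $aL^b(X)=\sup\{aL(C,X): C\text{ is }c_b\text{-closed}\}+\aleph_0$ and $aL'(X)=\min\{aL^b(X): b\text{ a section}\}$. Fix any section $b'$ with $aL^{b'}(X)=aL'(X)$ and write $\widehat{U}=\widehat{U}_{b'}$. For $A\subseteq X$ with $|A|\geq\kappa$ let $c^\kappa(A)=\{x\in X: |\widehat{U}\cap A|\geq\kappa\text{ for every open }U\ni x\}$. $X$ is $\kappa H''$-closed if for every $A\subseteq X$ with $|A|\geq\kappa$ and every family $\mathcal U$ of open sets of $X$ covering $c^\kappa(A)$ there is $\mathcal V\subseteq\mathcal U$ with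 $|\mathcal V|\leq\kappa$ and $|A\setminus\bigcup_{V\in\mathcal V}\widehat{V}|<\kappa$. (In particular, $X$ is $\kappa H''$-closed if $|X|<\kappa$.) *)

(* Defs.v *)
From HB Require Import structures.
From mathcomp Require Import all_boot all_classical topology.

Set Implicit Arguments.
Unset Strict Implicit.
Unset Printing Implicit Defensive.

Local Open Scope classical_set_scope.
Local Open Scope card_scope.

(* Cardinals are represented by types and compared through the library's
   [#<=] and [#=] on full sets, so that equality of cardinals is
   equipotence. *)

Definition cardinal := Type.

Definition card_lt T U (A : set T) (B : set U) := (A #<= B) && ~~ (B #<= A).
Notation "A '#<' B" := (card_lt A B)
  (at level 79, format "A  '#<'  B") : card_scope.

Lemma card_leTP (K L : cardinal) :
  reflect (exists f : K -> L, injective f) ([set: K] #<= [set: L]).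
Proof.
have [/cid[l _]|L0] := pselect (exists l : L, True).
  pose Lp : pointedType := HB.pack L (gen_eqMixin L) (gen_choiceMixin L)
    (isPointed.Build L l).
  apply: (iffP (@pcard_injP K Lp setT)) => -[f finj]; exists f.
    by move=> x y; apply: finj; rewrite inE.
  by move=> x y _ _; apply: finj.
apply: (iffP idP) => [KL|[f _]].
  have L0' : [set: L] = set0 by rewrite -subset0 => y _; case: L0; exists y.
  move: KL; rewrite L0' => /card_le0P K0.
  have nK (k : K) : False by have : [set: K] k by []; rewrite K0.
  by exists (fun k => False_rect _ (nK k)) => x; case: (nK x).
suff -> : [set: K] = set0 by [].
by rewrite -subset0 => k _; case: L0; exists (f k).
Qed.

(* Zorn's lemma on partial transversals: a maximal subset of the product of
   the family on which all projections are injective projects onto some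
   member of the family. *)
Lemma ex_least_family (I : Type) (i0 : I) (F : I -> cardinal) :
  exists i, forall j, [set: F i] #<= [set: F j].
Proof.
pose Q (S : set (forall i, F i)) :=
  forall u v, S u -> S v -> forall i, u i = v i -> u = v.
have [|S [QS maxS]] := @Zorn_bigcup (forall i, F i) Q.
  move=> G GQ Gtot u v [A GA Au] [B GB Bv] i uv.
  by have [AB|BA] := Gtot _ _ GA GB;
    [apply: (GQ _ GB _ _ (AB _ Au) Bv i)|apply: (GQ _ GA _ _ Au (BA _ Bv) i)].
have [[i surj]|nsurj] :=
  pselect (exists i, forall y : F i, exists2 u, S u & u i = y).
  have [g gS] := choice (fun y => let: ex_intro2 u Su uy := surj y in
     ex_intro (fun u => S u /\ u i = y) u (conj Su uy)).
  exists i => j; apply/card_leTP; exists (fun y => g y j) => y z gyz.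
  have [[Sy gy] [Sz gz]] := (gS y, gS z).
  by rewrite -gy -gz (QS _ _ Sy Sz _ gyz).
have miss i : exists y : F i, forall u, S u -> u i <> y.
  apply: contrapT => /forallNP h; apply: nsurj; exists i => y.
  have /existsNP[u /not_implyP[Su /contrapT uy]] := h y.
  by exists u.
pose w i := projT1 (cid (miss i)).
have wP i u : S u -> u i <> w i by rewrite /w; case: cid => y /= + Su; apply.
exfalso; apply: (maxS (S `|` [set w])).
  split=> [u Su|/(_ w)]; first by left.
  by move=> /(_ (or_intror erefl)) Sw; case: (wP i0 w Sw).
move=> u v [Su|->] [Sv|->] i uv //; first exact: QS uv.
  by case: (wP i u Su).
by case: (wP i v Sv); rewrite -uv.
Qed.

Lemma card_le_total (K L : cardinal) :
  [set: K] #<= [set: L] \/ [set: L] #<= [set: K].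
Proof.
have [[] h] := @ex_least_family bool true (fun b => if b then K else L).
- by left; exact: (h false).
- by right; exact: (h true).
Qed.

Definition is_least_cardinal (P : cardinal -> Prop) (K : cardinal) :=
  P K /\ forall L, P L -> [set: K] #<= [set: L].

Lemma ex_least_cardinal (P : cardinal -> Prop) :
  (exists K, P K) -> exists K, is_least_cardinal P K.
Proof.
move=> [K0 PK0].
pose R (A : set K0) := exists K, P K /\ [set: K] #= A.
have R0 : R setT by exists K0; split=> //; exact: card_eqxx.
have [[A [K [PK KA]]] /= h] :=
  @ex_least_family {A | R A} (exist R _ R0) (fun A => set_type (sval A)).
have KT (B : set K0) : [set: B] #= B by exact: card_setT.
have AE (B : set K0) : R B -> [set: K] #<= B.
  move=> RB; have := h (exist R B RB); rewrite /= (card_le_eqr (KT B)).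
  by rewrite (card_le_eql (KT A)) -(card_le_eql KA).
exists K; split=> // L PL.
have [LK|KL] := card_le_total L K0; last first.
  exact: card_le_trans (AE _ R0) KL.
have /card_leTP[f finj] := LK.
have Lf : [set: L] #= range f.
  rewrite card_eq_sym; apply: inj_card_eq; exact: in2W.
by rewrite (card_le_eqr Lf); apply: AE; exists L.
Qed.

Definition least_cardinal (P : cardinal -> Prop) (P0 : exists K, P K) :
  cardinal := projT1 (cid (ex_least_cardinal P0)).

Lemma least_cardinalP (P : cardinal -> Prop) (P0 : exists K, P K) :
  is_least_cardinal P (least_cardinal P0).
Proof. by rewrite /least_cardinal; case: cid. Qed.

Lemma ex_card_ub (I : cardinal) (F : I -> cardinal) :
  exists K : cardinal, forall i, [set: F i] #<= [set: K].
Proof.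
exists {i & F i} => i; apply/card_leTP; exists (existT F i) => x y.
exact: (@existT_inj2 (HB.pack I (gen_eqMixin I)) F i).
Qed.

Definition card_sup (I : cardinal) (F : I -> cardinal) : cardinal :=
  least_cardinal (ex_card_ub F).

Lemma card_supP (I : cardinal) (F : I -> cardinal) :
  is_least_cardinal (fun K => forall i, [set: F i] #<= [set: K]) (card_sup F).
Proof. exact: least_cardinalP. Qed.

Section OpenUltrafilters.
Variable X : topologicalType.
Implicit Types F G : set (set X).

(* A nonempty filter in the lattice of open sets contains the whole space, so
   [F setT] says that [F] is nonempty. *)
Definition open_filter F := [/\ F `<=` open, F setT, ~ F set0,
  forall U V, F U -> F V -> F (U `&` V) &
  forall U V, F U -> open V -> U `<=` V -> F V].

Definition open_ultrafilter F :=
  open_filter F /\ forall G, open_filter G -> F `<=` G -> G = F.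

Definition open_cvg F (x : X) := forall U, open U -> U x -> F U.

Definition EX := {F | open_ultrafilter F /\ exists x, open_cvg F x}.

Definition section := {b : X -> EX | forall x, open_cvg (sval (b x)) x}.

Lemma ex_open_ultrafilter (x : X) :
  exists F, open_ultrafilter F /\ open_cvg F x.
Proof.
pose N := [set U : set X | open U /\ U x].
have fN : open_filter N.
  split=> [U []//|||U V [oU Ux] [oV Vx]|U V [oU Ux] oV UV].
  - by split=> //; exact: openT.
  - by case.
  - by split; [exact: openI|].
  - by split=> //; exact: UV.
pose P F := F = set0 \/ (open_filter F /\ N `<=` F).
have [G GP Gtot|F [PF maxF]] := @Zorn_bigcup (set X) P.
  have [[F0 GF0 F0n]|G0] := pselect (exists2 F, G F & F !=set0); last first.
    left; rewrite -subset0 => U [F GF FU]; apply: G0; exists F => //.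
    by exists U.
  have GPn F U : G F -> F U -> open_filter F /\ N `<=` F.
    by move=> GF FU; case: (GP _ GF) FU => [->|].
  have [U0 F0U0] := F0n.
  have [[_ F0T _ _ _] NF0] := GPn _ _ GF0 F0U0.
  right; split; last by move=> U NU; exists F0 => //; exact: NF0.
  split.
  - by move=> U [F GF FU]; have [[FO _ _ _ _] _] := GPn _ _ GF FU; exact: FO.
  - by exists F0.
  - by move=> [F GF FU]; have [[_ _ + _ _] _] := GPn _ _ GF FU; exact.
  - move=> U V [F GF FU] [F' GF' F'V].
    have [[_ _ _ FI _] _] := GPn _ _ GF FU.
    have [[_ _ _ F'I _] _] := GPn _ _ GF' F'V.
    have [FF'|F'F] := Gtot _ _ GF GF'.
      by exists F' => //; apply: F'I => //; exact: FF'.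
    by exists F => //; apply: FI => //; exact: F'F.
  - move=> U V [F GF FU] oV UV; exists F => //.
    by have [[_ _ _ _ FS] _] := GPn _ _ GF FU; exact: FS UV.
have NT : N setT by split; [exact: openT|].
have {PF}[F0|[fF NF]] := PF.
  exfalso; apply: (maxF N); last by rewrite /P; right; split.
  by rewrite F0 properEneq; split; [apply/eqP => N0; rewrite -N0 in NT|].
exists F; split; last by move=> U oU Ux; exact: NF.
split=> // G fG FG; apply: contrapT => GF; apply: (maxF G).
  by rewrite properEneq; split=> //; apply/eqP => ?; exact: GF.
by rewrite /P; right; split=> //; exact: subset_trans FG.
Qed.

Lemma ex_section : exists b : section, True.
Proof.
have h (x : X) : exists p : EX, open_cvg (sval p) x.
  have [F [uF Fx]] := ex_open_ultrafilter x.
  by exists (exist _ F (conj uF (ex_intro _ x Fx))).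
by have [b bP] := choice h; exists (exist _ b bP).
Qed.

Variable b : section.

Definition hat (U : set X) : set X := [set x | sval (sval b x) U].

Definition cb (A : set X) : set X :=
  [set x | forall U, open U -> U x -> hat U `&` A !=set0].

Definition cb_closed (A : set X) := cb A = A.

(* Only meant for sets [A] of cardinality at least [K]. *)
Definition ckappa (K : cardinal) (A : set X) : set X :=
  [set x | forall U, open U -> U x -> [set: K] #<= hat U `&` A].

Definition kappaHpp_closed (K : cardinal) :=
  forall A : set X, [set: K] #<= A ->
  forall UU : set (set X), UU `<=` open ->
    ckappa K A `<=` \bigcup_(U in UU) U ->
  exists VV : set (set X), [/\ VV `<=` UU, VV #<= [set: K] &
    A `\` \bigcup_(V in VV) hat V #< [set: K]].

End OpenUltrafilters.

Section AlmostLindelof.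
Variable X : topologicalType.

(* [aL A] is the least [K] satisfying [aL_bound A]. *)
Definition aL_bound (A : set X) (K : cardinal) :=
  infinite_set [set: K] /\
  forall VV : set (set X), VV `<=` open -> A `<=` \bigcup_(V in VV) V ->
  exists WW : set (set X), [/\ WW `<=` VV, WW #<= [set: K] &
    A `<=` \bigcup_(W in WW) closure W].

Lemma ex_aL_bound (A : set X) : exists K, aL_bound A K.
Proof.
exists (set X + nat)%type; split.
  by apply/infiniteP/card_leTP; exists inr => m n [].
move=> VV _ AVV; exists VV; split=> //.
  apply: card_le_trans (subset_card_le (@subsetT _ VV)) _.
  by apply/card_leTP; exists inl => U V [].
by apply: subset_trans AVV _; apply: subset_bigcup => V _; exact: subset_closure.
Qed.

Definition aL (A : set X) : cardinal := least_cardinal (ex_aL_bound A).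

(* The disjoint sum with [nat] is the cardinal sum with aleph_0. *)
Definition aLb (b : section X) : cardinal :=
  (card_sup (fun C : {C : set X | cb_closed b C} => aL (sval C)) + nat)%type.

Lemma ex_aLb :
  exists K : cardinal, exists b : section X, [set: K] #= [set: aLb b].
Proof. by have [b _] := ex_section X; exists (aLb b), b; exact: card_eqxx. Qed.

Definition aL' : cardinal := least_cardinal ex_aLb.

End AlmostLindelof.

(* Main.v *)
(** The remark that makes the proof short: for a nonempty [K], every
    [c_b]-closed set [C] contains [ckappa b K C], so an open cover of [C] may
    be fed to the definition of a [kappaHpp_closed] space.  This yields a
    subfamily of size at most [K] whose hats cover [C] up to fewer than [K]
    points; the closure of an open set contains its hat, and the remaining
    points are covered one at a time. *)

Require Import Defs.
From mathcomp Require Import all_boot all_classical topology.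

Local Open Scope classical_set_scope.
Local Open Scope card_scope.

Lemma card_le_sum (A B A' B' : cardinal) :
  [set: A] #<= [set: A'] -> [set: B] #<= [set: B'] ->
  [set: A + B] #<= [set: A' + B'].
Proof.
move=> /card_leTP[f finj] /card_leTP[g ginj]; apply/card_leTP.
exists (fun z => match z with inl a => inl (f a) | inr b => inr (g b) end).
by move=> [a|b] [a'|b'] // [] => [/finj|/ginj] ->.
Qed.

(** The factor [nat] absorbs the doubling: one copy takes the even second coordinates, the other the
    odd ones. *)
Lemma card_le_prod_nat_double (S : cardinal) :
  [set: S * nat + S * nat] #<= [set: S * nat].
Proof.
apply/card_leTP; exists (fun z => match z with
  | inl p => (p.1, p.2.*2) | inr p => (p.1, p.2.*2.+1) end).
have oddE m n : m.*2 = n.*2.+1 -> False.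
  by move=> /(congr1 odd); rewrite /= !odd_double.
move=> [[s m]|[s m]] [[t n]|[t n]] [] -> //=.
- by move=> /double_inj ->.
- by move=> /oddE.
- by move=> /esym/oddE.
- by move=> /double_inj ->.
Qed.

(* Maximality of a family of pairwise disjoint injective sequences leaves only
   finitely many points of [K] uncovered. *)
Lemma infinite_prod_nat_decomp (K : cardinal) : infinite_set [set: K] ->
  exists S : cardinal, [/\ [set: nat] #<= [set: S * nat],
    [set: S * nat] #<= [set: K] & [set: K] #<= [set: S * nat + nat]].
Proof.
move=> Kinf.
have [E [Einj Edisj maxE]] := @ex_maximal_disjoint_subcollection _ K
  (fun s : nat -> K => range s) [set s | injective s].
pose T := \bigcup_(s in E) range s.
(* An infinite complement would contain the range of an injective sequence, and adding that sequence
   to [E] would contradict maximality. *)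
have finT : finite_set (~` T).
  apply: contrapT => /infiniteP; rewrite -(card_le_eqr (card_setT _)).
  move=> /card_leTP[f finj]; pose s n := val (f n).
  have sinj : injective s by move=> m n /val_inj /finj.
  have sT n : ~ T (s n) by have := valP (f n); rewrite inE.
  have Es : ~ E s by move=> Es; apply: (sT 0); exists s => //; exists 0.
  apply: (maxE (E `|` [set s])).
  - split=> [t Et|]; first by left.
    by move=> /(_ s (or_intror erefl)).
  - by move=> t [/Einj//|->].
  - move=> t u [Et|->] [Eu|->] // [k [[m _ mk] [n _ nk]]].
    + by apply: Edisj => //; exists k; split; [exists m|exists n].
    + by exfalso; apply: (sT n); rewrite nk -mk; exists t => //; exists m.
    + by exfalso; apply: (sT m); rewrite mk -nk; exists u => //; exists n.
(* Were [T] empty, [K] would be finite. The sequence [s0] inhabits [S], so that [nat] embeds in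
   [S * nat]. *)
have [k0 [s0 Es0 _]] : T !=set0.
  apply: contrapT => /set0P/negP/negPn/eqP T0; apply: Kinf.
  by rewrite -setC0 -T0.
exists {s | E s}; split.
- by apply/card_leTP; exists (pair (exist _ s0 Es0)) => m n [].
- apply/card_leTP; exists (fun p => sval p.1 p.2).
  move=> [[s Es] m] [[t Et] n] /= smtn.
  have st : s = t by apply: Edisj => //; exists (s m); split; [exists m|exists n].
  subst t; rewrite (Einj _ Es _ _ smtn).
  by congr (exist _ _ _, _); exact: Prop_irrelevance.
have : [set: ~` T] #<= [set: nat].
  by rewrite (card_le_eql (card_setT _)); exact: finite_set_countable.
move=> /card_leTP[r rinj]; apply/card_leTP.
(* A code determines its point, by evaluating the sequence or by injectivity of [r], so any choice
   of codes is injective. *)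
have code k : exists z : {s | E s} * nat + nat,
    match z with
    | inl p => sval p.1 p.2 = k
    | inr n => exists2 u : ~` T, val u = k & r u = n
    end.
  have [[s Es [n _ snk]]|nTk] := pselect (T k).
    by exists (inl (exist _ s Es, n)).
  pose u : ~` T := exist _ k (mem_set nTk).
  by exists (inr (r u)), u.
have [g gP] := choice code; exists g => k l gkl.
move: (gP k) (gP l); rewrite gkl; case: (g l) => [p -> //|n].
by move=> [u <- <-] [v <- /rinj ->].
Qed.

(** [K] is equipotent to some [S * nat], since the extra summand [nat] fits into a second copy of
    [S * nat]; doubling is then absorbed. *)
Lemma card_le_infinite_double (K : cardinal) : infinite_set [set: K] ->
  [set: K + K] #<= [set: K].
Proof.
move=> /infinite_prod_nat_decomp[S [natS SK KS]].
have dS := card_le_prod_nat_double S.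
have KS' : [set: K] #<= [set: S * nat].
  apply: card_le_trans KS (card_le_trans _ dS).
  exact: card_le_sum (card_lexx _) natS.
exact: card_le_trans (card_le_sum _ _ _ _ KS' KS') (card_le_trans dS SK).
Qed.

Lemma card_le_setU (K : cardinal) (T : Type) (A B : set T) :
  infinite_set [set: K] -> A #<= [set: K] -> B #<= [set: K] ->
  A `|` B #<= [set: K].
Proof.
move=> Kinf AK BK.
rewrite -(card_le_eql (card_setT _)).
apply: card_le_trans (card_le_infinite_double _ Kinf).
apply: (@card_le_trans _ _ _ [set: A + B]); last first.
  by apply: card_le_sum; rewrite (card_le_eql (card_setT _)).
have split_U (x : A `|` B) : exists z : A + B,
    match z with inl a => val a | inr b => val b end = val x.
  have [Ax|Bx] := set_mem (valP x).
    by exists (inl (exist (fun y => y \in A) _ (mem_set Ax))).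
  by exists (inr (exist (fun y => y \in B) _ (mem_set Bx))).
have [f fP] := choice split_U; apply/card_leTP; exists f => x y fxy.
by apply: val_inj; rewrite -fP fxy fP.
Qed.

Lemma subset_bigcup_card_le (T : Type) (A : set T) (V : set (set T)) :
  A `<=` \bigcup_(U in V) U ->
  exists W, [/\ W `<=` V, W #<= A & A `<=` \bigcup_(U in W) U].
Proof.
move=> AV.
have /choice[f fP] (x : T) : exists U, A x -> V U /\ U x.
  (* Off [A] the value [setT] is a dummy: [W] is the image of [A] alone. *)
  have [Ax|nAx] := pselect (A x); last by exists setT => /nAx.
  by have [U VU Ux] := AV _ Ax; exists U.
exists (f @` A); split; last 1 first.
- by move=> x Ax; exists (f x); [exists x|have [] := fP _ Ax].
- by move=> _ [x Ax <-]; have [] := fP _ Ax.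
exact: card_image_le.
Qed.

(** If [x] lies outside [closure U], the complement of [closure U] is an open neighbourhood of [x],
    hence a member of the ultrafilter at [x]; it is disjoint from [U], so [U] cannot be a member
    too. *)
Lemma hat_subset_closure {X : topologicalType} (b : section X) (U : set X) :
  hat b U `<=` closure U.
Proof.
move=> x bxU; apply: contrapT => nUx.
have [[[_ _ n0 bI _] _] _] := svalP (sval b x).
apply: n0; rewrite -(_ : U `&` ~` closure U = set0).
  by apply: bI => //; apply: (svalP b) => //; apply/closed_openC/closed_closure.
by rewrite -subset0 => y [Uy []]; exact: subset_closure.
Qed.

Lemma ckappa_subset_cb {X : topologicalType} (b : section X) (K : cardinal)
    (A : set X) : [set: K] !=set0 -> ckappa b K A `<=` cb b A.
Proof.
move=> K0 x xA U oU Ux; apply/set0P/negP => /eqP UA0.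
have := xA U oU Ux; rewrite UA0 => /card_le0P K00.
by case: K0 => k; rewrite K00.
Qed.

Lemma cb_closed_aL_bound {X : topologicalType} (b : section X) (K : cardinal)
    (C : set X) : infinite_set [set: K] -> kappaHpp_closed b K ->
  cb_closed b C -> aL_bound C K.
Proof.
move=> Kinf hH bC; split=> // V oV CV.
(* Used twice: for [C] itself when it has at most [K] points, and for the points that the hats miss
   when [C] is large. *)
have few_points (D : set X) : D `<=` C -> D #<= [set: K] ->
    exists W, [/\ W `<=` V, W #<= [set: K] & D `<=` \bigcup_(U in W) closure U].
  move=> DC DK.
  have [W [WV WD DW]] := subset_bigcup_card_le _ _ _ (subset_trans DC CV).
  exists W; split=> //; first exact: card_le_trans WD DK.
  by apply: subset_trans DW _; apply: subset_bigcup => U _; exact: subset_closure.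
have [CK|KC] := card_le_total (set_type C) K.
  by apply: few_points => //; rewrite -(card_le_eql (card_setT _)).
rewrite (card_le_eqr (card_setT _)) in KC.
have [|W1 [W1V W1K /andP[DK _]]] := hH C KC V oV.
  (* Rewriting the right-hand [C] as [cb b C] reduces the inclusion of [ckappa b K C] in [C] to
     [ckappa_subset_cb]. *)
  apply: subset_trans CV; rewrite -{2}bC.
  exact/ckappa_subset_cb/infinite_setN0.
have [W2 [W2V W2K DW2]] := few_points _ (@subDsetl _ _ _) DK.
exists (W1 `|` W2); split.
- by move=> U [/W1V|/W2V].
- exact: card_le_setU.
move=> x Cx; have [[U W1U xU]|nW1x] := pselect ((\bigcup_(U in W1) hat b U) x).
  by exists U; [left|exact: hat_subset_closure xU].
by have [U W2U Ux] := DW2 x (conj Cx nW1x); exists U => //; right.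
Qed.

Theorem proposition5p18 (K : cardinal) (hK : infinite_set [set: K])
    (X : topologicalType) (hX : hausdorff_space X)
    (b' : section X) (hb' : [set: aLb b'] #= [set: aL' X])
    (hH : kappaHpp_closed b' K) :
  [set: aL' X] #<= [set: K].
Proof.
rewrite -(card_le_eql hb').
(* [aLb b'] is a supremum plus [nat], so bounding each summand by [K] is enough. *)
apply: card_le_trans (card_le_infinite_double _ hK).
apply: card_le_sum; last exact/infiniteP.
apply: (card_supP _).2 => -[C bC] /=.
by apply: (least_cardinalP (ex_aL_bound C)).2; exact: cb_closed_aL_bound bC.
Qed.
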